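(* $(\mathbb{R}_2,\leq_2)$ is distributive: whenever $R$ and $(S_i)_{i\in I}$ are relations (viewed as problems) with $R\leq_2\lceil S_i\rceil_{i\in I}$, there are relations $(R_i)_{i\in I}$ with $R_i\leq_2 S_i$ for all $i\in I$ and $R\equiv_2\lceil R_i\rceil_{i\in I}$.
   Context: A partial function $F:\subseteq X\to Y$ is continuous if continuous on $\operatorname{dom}(F)$ with the subspace topology. A problem $P:\underline{X}\to\underline{Y}$ is a set of partial functions from $\underline{X}$ to $\underline{Y}$. A relation $R\subseteq X\times Y$ between topological spaces is identified with the problem consisting of its choice functions, i.e. functions $f$ defined on $\{x\mid\exists y\,(x,y)\in R\}$ with $(x,f(x))\in R$. For problems $P:\underline{X}_1\to\underline{Y}_1$, $Q:\underline{X}_2\to\underline{Y}_2$, $P\leq_2 Q$ means there are continuous partial $F:\subseteq\underline{X}_1\times\underline{Y}_2\to\underline{Y}_1$, $G:\subseteq\underline{X}_1\to\underline{X}_2$ such that $(x\mapsto F(x,g(G(x))))\in P$ for all $g\in Q$; $\equiv_2$ is the induced equivalence, and $\mathbb{R}_2$ is the class of equivalence classes of relations. Coproduct $\coprod_i\underline{X}_i=\bigcup_i\{i\}\times X_i$ with topology generated by the sets $\{i\}\times U$, $U$ open in $\underline{X}_i$; $\lceil f_i\rceil_{i\in I}(i,x)=(i,f_i(x))$ and $\lceil P_i\rceil_{i\in I}=\{\lceil f_i\rceil_{i\in I}\mid f_i\in P_i\ \forall i\}$; for relations this is again (the problem of) a relation, and it is known that it is the supremum in $(\mathbb{R}_2,\leq_2)$,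 which is a complete join-semilattice. A complete join-semilattice is distributive iff $x\leq\sup_i y_i$ implies the existence of $(x_i)_i$ with $x_i\leq y_i$ and $x=\sup_i x_i$. *)

(* Defs.v *)
From HB Require Import structures.
From mathcomp Require Import all_boot all_order all_algebra.
From mathcomp Require Import all_classical topology.

Set Implicit Arguments.
Unset Strict Implicit.
Unset Printing Implicit Defensive.

Local Open Scope classical_set_scope.

(* Partial functions are option-valued: [F x = None] means that [x] is outside
   the domain. Thus equality of partial functions includes equality of domains,
   and spaces may be empty. *)
Definition pfun (X Y : Type) : Type := X -> option Y.

Definition pdom (X Y : Type) (F : pfun X Y) : set X := [set x | isSome (F x)].

(* The total function [f] induced by [F] on the type of points of [pdom F] is
   continuous, that type carrying the subspace topology (the topology that the
   library puts on [set_type]). *)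
Definition pcontinuous (X Y : topologicalType) (F : pfun X Y) : Prop :=
  exists2 f : set_type (pdom F) -> Y,
    continuous f & forall x : set_type (pdom F), F (set_val x) = Some (f x).

Definition problem (X Y : Type) : Type := set (pfun X Y).

Definition rel_problem (X Y : Type) (R : set (X * Y)) : problem X Y :=
  [set f | pdom f = [set x | exists y, R (x, y)] /\
           forall x y, f x = Some y -> R (x, y)].

(* x |-> F(x, g(G(x))), defined at x iff G(x), g(G(x)) and F(x, g(G(x))) are. *)
Definition reduct (X1 Y1 X2 Y2 : Type)
    (F : pfun (X1 * Y2) Y1) (G : pfun X1 X2) (g : pfun X2 Y2) : pfun X1 Y1 :=
  fun x => obind (fun z => obind (fun y => F (x, y)) (g z)) (G x).

Definition le2 (X1 Y1 X2 Y2 : topologicalType)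
    (P : problem X1 Y1) (Q : problem X2 Y2) : Prop :=
  exists (F : pfun (X1 * Y2) Y1) (G : pfun X1 X2),
    [/\ pcontinuous F, pcontinuous G &
        forall g, Q g -> P (reduct F G g)].

Definition equiv2 (X1 Y1 X2 Y2 : topologicalType)
    (P : problem X1 Y1) (Q : problem X2 Y2) : Prop :=
  le2 P Q /\ le2 Q P.

(* ⌈f_i⌉(i, x) = (i, f_i(x)), defined iff f_i(x) is. The coproduct space is the
   library's topology on [{i & X i}], which asks the index type to be a
   [choiceType]. *)
Definition coprod_pfun (I : choiceType) (X Y : I -> Type)
    (f : forall i, pfun (X i) (Y i)) : pfun {i & X i} {i & Y i} :=
  fun p => omap (existT Y (projT1 p)) (f (projT1 p) (projT2 p)).

Definition coprod (I : choiceType) (X Y : I -> Type)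
    (P : forall i, problem (X i) (Y i)) : problem {i & X i} {i & Y i} :=
  [set h | exists2 f : forall i, pfun (X i) (Y i),
     (forall i, P i (f i)) & h = coprod_pfun f].

(* Main.v *)
Require Import Defs.
From HB Require Import structures.
From mathcomp Require Import all_boot all_order all_algebra.
From mathcomp Require Import all_classical topology.

Set Implicit Arguments.
Unset Strict Implicit.

Local Open Scope classical_set_scope.

(** Let [F], [G] reduce [R] to the coproduct of the [S i]. The restriction
    [piece R G i] of [R] to the points that [G] sends into the [i]-th summand
    reduces to [S i], because a solution of [S i] extends to one of the
    coproduct. The summands are open in the coproduct, so [G] reads off
    continuously to which piece a point belongs, which makes [R] equivalent to
    the coproduct of its pieces. *)

Section PartialContinuity.
Context {X Y : topologicalType}.
Implicit Types F : pfun X Y.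

(** Open sets of the subspace are traces of open sets of [X], so continuity can be tested on nearby
    points of [X] that lie in the domain, without the type [set_type (pdom F)]. *)
Lemma pcontinuousP F : pcontinuous F <->
  forall x y, F x = Some y -> forall V, nbhs y V ->
    \forall z \near x, forall w, F z = Some w -> V w.
Proof.
split=> [[f fc fE] x y Fx V Vy|Fc].
  have xF : x \in pdom F by rewrite inE /pdom /= Fx.
  have := fE (SigSub xF); rewrite set_valE /= Fx => -[yE].
  rewrite yE in Vy; have [_ [[W oW <-] Wx WV]] := fc _ _ Vy.
  have : nbhs x W by apply: open_nbhs_nbhs; split.
  apply: filterS => z Wz w Fz.
  have zF : z \in pdom F by rewrite inE /pdom /= Fz.
  have := fE (SigSub zF); rewrite set_valE /= Fz => -[->].
  exact: WV.
have ex (x : set_type (pdom F)) : {y | F (set_val x) = Some y}.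
  apply: cid; have : pdom F (set_val x) by case: x => x xF; exact: set_mem.
  by rewrite /pdom /=; case: (F _) => // y _; exists y.
exists (fun x => sval (ex x)) => [x V|x]; last by case: (ex x).
case: (ex x) => y /= Fx Vy.
have [W [oW Wx] WV] : exists2 W, open_nbhs (set_val x) W &
    W `<=` [set z | forall w, F z = Some w -> V w].
  by move: (Fc _ _ Fx _ Vy); rewrite /prop_near1 {1}nbhsE.
exists (set_val @^-1` W); split => //=; first by exists W.
by move=> z /= Wz; case: (ex z) => w /= Fz; apply: WV Fz.
Qed.

Lemma pcontinuous_sub {F F'} : pcontinuous F ->
  (forall x y, F' x = Some y -> F x = Some y) -> pcontinuous F'.
Proof.
move=> /pcontinuousP Fc FF'; apply/pcontinuousP => x y /FF' Fx V Vy.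
by apply: filterS (Fc _ _ Fx _ Vy) => z h w /FF'; exact: h.
Qed.

Lemma pcontinuous_Some (f : X -> Y) :
  continuous f -> pcontinuous (fun x => Some (f x)).
Proof.
move=> fc; apply/pcontinuousP => x _ [<-] V Vfx.
have : nbhs x (f @^-1` V) by exact: fc.
by apply: filterS => z /= Vz _ [<-].
Qed.

End PartialContinuity.

Lemma pcontinuous_comp {X Y Z : topologicalType} (F : pfun Y Z) (h : X -> Y) :
  pcontinuous F -> continuous h -> pcontinuous (F \o h).
Proof.
move=> /pcontinuousP Fc hc; apply/pcontinuousP => x y Fhx V Vy.
exact: (hc x) (Fc _ _ Fhx _ Vy).
Qed.

Section ChoiceFunction.
Context {X Y : Type}.
Implicit Type R : set (X * Y).

Definition choice_pfun R : pfun X Y := fun x =>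
  if pselect (exists y, R (x, y)) is left xR then Some (projT1 (cid xR))
  else None.

(** By the axiom of choice, the problem of a relation is never empty. *)
Lemma choice_pfunP R : rel_problem R (choice_pfun R).
Proof.
split=> [|x y]; rewrite /pdom /choice_pfun; last first.
  by case: pselect => // xR [<-]; case: cid.
by apply/seteqP; split=> x /=; case: pselect.
Qed.

Lemma rel_problemP R (f : pfun X Y) : rel_problem R f <->
  (forall x y, R (x, y) -> isSome (f x)) /\
  (forall x y, f x = Some y -> R (x, y)).
Proof.
split=> [[fdom fR]|[fdom fR]]; split=> //.
  by move=> x y xyR; have : pdom f x by rewrite fdom; exists y.
apply/seteqP; split=> x /=; last by case=> y; exact: fdom.
by rewrite /pdom /=; case fx : (f x) => [y|] // _; exists y; exact: fR.
Qed.

End ChoiceFunction.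

Section Coproduct.
Context {I : choiceType}.

(** Equality proofs in a [choiceType] are unique, so the transport between the second components is
    trivial. *)
Lemma existT_inj {A : I -> Type} i : injective (existT A i).
Proof.
move=> a b ab; have /= := projT2_eq ab.
by rewrite (eq_irrelevance (projT1_eq ab) erefl).
Qed.

(** The summands other than [i] are filled with arbitrary choice functions. *)
Lemma coprod_extend {A B : I -> Type} (S : forall i, set (A i * B i)) i f :
  rel_problem (S i) f ->
  exists2 g, coprod (fun j => rel_problem (S j)) g &
    forall a, g (existT A i a) = omap (existT B i) (f a).
Proof.
move=> fS.
pose h := @dfwith I (fun j => pfun (A j) (B j)) (fun j => choice_pfun (S j)) i f.
exists (coprod_pfun h).
  by exists h => // j; rewrite /h; case: dfwithP => // k _; exact: choice_pfunP.
by move=> a; rewrite /coprod_pfun /= /h dfwithin.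
Qed.

Lemma projT2_continuous (X : topologicalType) :
  continuous (fun p : {i : I & X} => projT2 p).
Proof. by case=> i x V. Qed.

(** The tag is locally constant on the coproduct, so near a given point only [p.2] varies. *)
Lemma retag_continuous (X Y : topologicalType) :
  continuous (fun p : {i : I & X} * Y => existT (fun=> Y) (projT1 p.1) p.2).
Proof.
case=> -[i x] y V /= Vy.
exists (existT (fun=> X) i @` setT, existT (fun=> Y) i @^-1` V).
  by split=> //=; apply: existT_nbhs; exact: filterT.
by case=> _ z [/= [x' _ <-] Vz].
Qed.

Lemma tag_snd_continuous (X : topologicalType) (B : I -> topologicalType) i :
  continuous (fun p : X * B i => (p.1, existT B i p.2)).
Proof.
case=> x b V [[P Q] [/= Px Qb] PQV].
exists (P, existT B i @^-1` Q); first by split.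
by case=> x' b' [/= Px' Qb']; exact: PQV.
Qed.

End Coproduct.

Section Pieces.
Context {X Y : topologicalType} {I : choiceType} {A B : I -> topologicalType}.
Variables (R : set (X * Y)) (S : forall i, set (A i * B i)).
Arguments S i : clear implicits.
Variables (F : pfun (X * {i & B i}) Y) (G : pfun X {i & A i}).
Hypotheses (Fc : pcontinuous F) (Gc : pcontinuous G).
Hypothesis FG : forall g, coprod (fun i => rel_problem (S i)) g ->
  rel_problem R (reduct F G g).

Definition piece i : set (X * Y) :=
  [set p | R p /\ exists a, G p.1 = Some (existT A i a)].

Lemma G_near x i a V : G x = Some (existT A i a) -> nbhs a V ->
  \forall z \near x, forall w, G z = Some w -> (existT A i @` V) w.
Proof.
by move=> Gx Va; move/pcontinuousP: Gc => /(_ _ _ Gx); apply; exact: existT_nbhs.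
Qed.

(** Any one solution of the coproduct suffices: the resulting reduct is defined at [x], which forces
    [G x] to be defined. Hence the pieces cover [R]. *)
Lemma domain_G x y : R (x, y) -> exists i a, G x = Some (existT A i a).
Proof.
have gS : coprod (fun i => rel_problem (S i))
    (coprod_pfun (fun i => choice_pfun (S i))).
  by exists (fun i => choice_pfun (S i)) => // i; exact: choice_pfunP.
have /rel_problemP[gR _] := FG gS.
by move=> /gR; rewrite /reduct; case: (G x) => [[i a]|] // _; exists i, a.
Qed.

Lemma piece_le i : le2 (rel_problem (piece i)) (rel_problem (S i)).
Proof.
(* [Q] is the graph of the [i]-th component of [G] over the domain of [R]; [existT_inj] makes it
   single-valued, so [Gi] is that component. *)
pose Q := [set p : X * A i |
  G p.1 = Some (existT A i p.2) /\ exists y, R (p.1, y)].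
pose Gi := choice_pfun Q.
have /rel_problemP[Gidom GiE] := choice_pfunP Q.
exists (F \o fun p => (p.1, existT B i p.2)), Gi; split.
- exact/pcontinuous_comp/tag_snd_continuous.
- apply/pcontinuousP => x a /GiE[Gx _] V Va.
  apply: filterS (G_near Gx Va) => z h a' /GiE[/= Gz _].
  by have [b Vb ba'] := h _ Gz; rewrite -(existT_inj ba').
- move=> f fS; have [g gS gE] := coprod_extend fS.
  have /rel_problemP[domR valR] := FG gS.
  (* Where [Gi] is defined, the extension [g] is only queried in the summand [i], where it agrees
     with [f]; domain and values then come from [FG]. *)
  have redE x a : Gi x = Some a ->
      reduct (F \o fun p => (p.1, existT B i p.2)) Gi f x = reduct F G g x.
    move=> Gix; have [Gx _] := GiE _ _ Gix.
    by rewrite /reduct Gix Gx /= gE; case: (f a).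
  apply/rel_problemP; split=> [x y [xyR [a Gx]]|x y].
    have : isSome (Gi x) by apply: (Gidom x a); split=> //; exists y.
    case Gix : (Gi x) => [a'|] // _.
    by rewrite (redE _ _ Gix); exact: domR xyR.
  case Gix : (Gi x) => [a|]; last by rewrite /reduct Gix.
  rewrite (redE _ _ Gix) => /valR xyR; split=> //.
  by have [Gx _] := GiE _ _ Gix; exists a.
Qed.

Lemma le_coprod_piece :
  @le2 X Y {i : I & X} {i : I & Y}
    (rel_problem R) (coprod (fun i => rel_problem (piece i))).
Proof.
(* The query is [x] itself, tagged with the piece that [G] selects; the answer then only has to lose
   its tag. *)
pose G' : pfun X {i : I & X} :=
  fun x => omap (fun p => existT (fun=> X) (projT1 p) x) (G x).
exists (fun p => Some (projT2 p.2)), G'; split.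
- apply: pcontinuous_Some => p.
  apply: (@cvg_comp _ _ _ snd (fun q : {i : I & Y} => projT2 q)).
    exact: cvg_snd.
  exact: projT2_continuous.
- apply/pcontinuousP => x p; rewrite /G'.
  case Gx : (G x) => [[i a]|] //= -[<-] V Vx.
  (* With the whole space as neighbourhood of [a], [G_near] says that the tag of [G] is constant
     near [x]. *)
  have Gi := G_near Gx (open_nbhs_nbhs (open_nbhsT a)).
  have {}Vx : nbhs x (existT (fun=> X) i @^-1` V) by [].
  apply: filterS2 Gi Vx => z h Vz w; case Gz : (G z) => [q|] //= -[<-].
  by have [b _ <-] := h _ Gz.
- move=> _ [f fT ->]; apply/rel_problemP; split=> [x y xyR|x y].
    have [i [a Gx]] := domain_G xyR.
    have /rel_problemP[/(_ x y) fdom _] := fT i.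
    rewrite /reduct /G' Gx /= /coprod_pfun /=.
    have : isSome (f i x) by apply: fdom; split=> //; exists a.
    by case: (f i x).
  rewrite /reduct /G'; case: (G x) => [[i a]|] //=.
  rewrite /coprod_pfun /=; case fx : (f i x) => [y'|] //= [<-].
  by have /rel_problemP[_ /(_ _ _ fx)[]] := fT i.
Qed.

Lemma coprod_piece_le :
  @le2 {i : I & X} {i : I & Y} X Y
    (coprod (fun i => rel_problem (piece i))) (rel_problem R).
Proof.
(* Forgetting the tag must be restricted to the domain of the piece: a solution of [R] also answers
   at points of other pieces, where the reduct has to be undefined. *)
pose cut (p : {i : I & X}) : option X :=
  if pselect (exists y, piece (projT1 p) (projT2 p, y)) then Some (projT2 p)
  else None.
exists (fun p => Some (existT (fun=> Y) (projT1 p.1) p.2)), cut; split.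
- exact/pcontinuous_Some/retag_continuous.
- apply: (pcontinuous_sub (pcontinuous_Some (@projT2_continuous _ X))).
  by move=> p x; rewrite /cut; case: pselect.
- move=> g /rel_problemP[gdom gR].
  (* The [i]-th solution is [g] restricted to the domain of [piece i]; its values stay in the piece
     because the condition on [G] concerns [x] alone. *)
  exists (fun i x => obind g (cut (existT (fun=> X) i x))).
    move=> i; apply/rel_problemP; split=> x y; rewrite /cut /=.
      move=> xyT; case: pselect => [xT|[]] /=; last by exists y.
      by case: xyT => xyR _; exact: gdom xyR.
    by case: pselect => [[y' [_ Gx]]|//] /= /gR.
  apply/funext => -[i x]; rewrite /reduct /coprod_pfun /=.
  by case: (cut _) => //= x'; case: (g x').
Qed.

End Pieces.

Theorem theorem4p22 (X Y : topologicalType) (R : set (X * Y))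
  (I : choiceType) (A B : I -> topologicalType)
  (S : forall i : I, set (A i * B i)) :
  @le2 X Y {i : I & A i} {i : I & B i}
    (rel_problem R) (coprod (fun i : I => rel_problem (S i))) ->
  exists (C D : I -> topologicalType) (T : forall i : I, set (C i * D i)),
    (forall i : I, le2 (rel_problem (T i)) (rel_problem (S i))) /\
    @equiv2 X Y {i : I & C i} {i : I & D i}
      (rel_problem R) (coprod (fun i : I => rel_problem (T i))).
Proof.
case=> F [G [Fc Gc FG]].
exists (fun=> X), (fun=> Y), (piece R G); split=> [i|].
  exact: piece_le FG i.
by split; [exact: le_coprod_piece FG | exact: coprod_piece_le].
Qed.
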